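(* Let $n\ge1$, $\sigma_1\ge\dots\ge\sigma_{n-1}\ge\sigma_n=1$, $\tau>0$ and $C\in\mathbb{R}$. The reduced Hamiltonian system obtained by symplectic reduction, at the momentum level $\lambda_{2n+1}=C$, of the LR system on $T^*H_{2n+1}$ (the normal sub-Riemannian geodesic flow of the left-invariant metric $g$ restricted to the right-invariant distribution $\mathcal{D}_R$) is equivalent to the Hamiltonian system describing the motion of a charged particle on $\mathbb{R}^{2n}$ in the constant magnetic field $$F=C\sum_{i=1}^n dx_i\wedge dy_i .$$
   Context: Heisenberg group: $H_{2n+1}=\mathbb{R}^{2n+1}$ with coordinates $(x,y,z)=(x_1,\dots,x_n,y_1,\dots,y_n,z)$, identified with matrices $\begin{pmatrix}1&x^T&z\\0&I_n&y\\0&0&1\end{pmatrix}$ under matrix multiplication. The left-invariant metric is $g=\sum_k\sigma_k(dx_k^2+dy_k^2)+\tau\big(dz-\sum_kx_k\,dy_k\big)^2$. The right-invariant distribution $\mathcal{D}_R$ is spanned by $X_k=\frac{\partial}{\partial x_k}+y_k\frac{\partial}{\partial z}$ and $Y_k=\frac{\partial}{\partial y_k}$, $k=1,\dots,n$. LR system: with $\lambda=(\lambda_1,\dots,\lambda_{2n+1})$ the momenta canonically conjugate to $(x,y,z)$ and $q=(x,y)$, it is the Hamiltonian system on $T^*H_{2n+1}$ (canonical bracket $\{f,h\}=\sum_i(\partial_{q_i}f\,\partial_{\lambda_i}h-\partial_{\lambda_i}f\,\partial_{q_i}h)$ over all $2n+1$ coordinate pairs) with $H=\frac12\sum_{a,b}g^{ab}P_aP_b$,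 where $P_a(\lambda)=\lambda(Z_a)$ for the frame $(Z_a)=(X_1,\dots,X_n,Y_1,\dots,Y_n)$ and $(g^{ab})$ is the inverse of the Gram matrix $g(Z_a,Z_b)$. Neither $g(Z_a,Z_b)$ nor $P_a$ depends on $z$, so $z$ is cyclic and $\lambda_{2n+1}$ is conserved. Reduced system: restrict to $\{\lambda_{2n+1}=C\}$ and quotient by translations in $z$; the quotient is $\mathbb{R}^{4n}$ with coordinates $(x,y,\lambda_1,\dots,\lambda_{2n})$ and canonical bracket, with the induced Hamiltonian. Charged particle: for a Riemannian metric $h=(h_{ij})$ on $\mathbb{R}^{2n}$ with coordinates $q_1,\dots,q_{2n}$ and a closed 2-form $F=\sum_{i<j}F_{ij}\,dq_i\wedge dq_j$, the motion of a charged particle in the magnetic field $F$ is the Hamiltonian system on $\mathbb{R}^{4n}=\{(q,p)\}$ with Hamiltonian $\frac12\sum h^{ij}p_ip_j$ and Poisson brackets $\{q_i,q_j\}=0$, $\{q_i,p_j\}=\delta_{ij}$, $\{p_i,p_j\}=F_{ij}$ (where $F_{ji}=-F_{ij}$). Here $(q_1,\dots,q_{2n})=(x_1,\dots,x_n,y_1,\dots,y_n)$ and $h$ is the metric on $\mathbb{R}^{2n}$ with matrix $h_{ab}(q)=g(Z_a,Z_b)=\big(D+\tau(Jq)(Jq)^T\big)_{ab}$, with $D=\mathrm{diag}(\sigma_1,\dots,\sigma_n,\sigma_1,\dots,\sigma_n)$ and $J=\begin{pmatrix} 0 & -E \\ E & 0 \end{pmatrix}$, $E$ the $n\times n$ identity.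 Equivalent means: there is a diffeomorphism of $\mathbb{R}^{4n}$, covering the identity of $\mathbb{R}^{2n}$ in the $q$ variables, carrying the Poisson structure and Hamiltonian of one system to those of the other. *)

(* Defs.v *)
From HB Require Import structures.
From mathcomp Require Import all_boot all_order all_algebra.
From mathcomp Require Import all_classical all_reals all_analysis.
From mathcomp Require Import ring lra.

Set Implicit Arguments.
Unset Strict Implicit.
Unset Printing Implicit Defensive.
Import Order.TTheory GRing.Theory Num.Theory.
Import numFieldNormedType.Exports.
Local Open Scope ring_scope.

(* T^*R^N = {(q, p)}, with p the momenta conjugate to q. *)
Notation phase R N := ('rV[R]_N * 'rV[R]_N)%type.

Section Smooth.
Context {R : realType}.

Fixpoint Ck (V W : normedModType R) (k : nat) (f : V -> W) : Prop :=
  if k is k'.+1 then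
    (forall x, differentiable f x) /\ (forall v, Ck k' (fun x => 'D_v f x))
  else continuous f.

Definition smooth (V W : normedModType R) (f : V -> W) : Prop :=
  forall k, Ck k f.

Definition diffeomorphism (V W : normedModType R) (phi : V -> W) : Prop :=
  smooth phi /\ exists2 psi : W -> V, smooth psi & cancel phi psi /\ cancel psi phi.

End Smooth.

Section HamiltonianSystems.
Context {R : realType} {N : nat}.

Definition basis_vec (i : 'I_N) : 'rV[R]_N := delta_mx 0 i.

Definition d_q (i : 'I_N) (f : phase R N -> R) (m : phase R N) : R :=
  'D_(basis_vec i, 0) f m.
Definition d_p (i : 'I_N) (f : phase R N -> R) (m : phase R N) : R :=
  'D_(0, basis_vec i) f m.

Definition canonical_bracket (f h : phase R N -> R) (m : phase R N) : R :=
  \sum_(i < N) (d_q i f m * d_p i h m - d_p i f m * d_q i h m).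

(* The value at (q, u, v) is F_q(u, v); F_ij(q) is its value on the basis
   vectors e_i, e_j. *)
Definition two_form := 'rV[R]_N -> 'rV[R]_N -> 'rV[R]_N -> R.

Definition two_form_coef (F : two_form) (q : 'rV[R]_N) (i j : 'I_N) : R :=
  F q (basis_vec i) (basis_vec j).

Definition dq (i : 'I_N) (u : 'rV[R]_N) : R := u 0 i.

Definition wedge (a b : 'rV[R]_N -> R) (u v : 'rV[R]_N) : R :=
  a u * b v - a v * b u.

Definition closed_two_form (F : two_form) : Prop :=
  forall (i j k : 'I_N) (q : 'rV[R]_N),
    'D_(basis_vec i) (fun q => two_form_coef F q j k) q
    + 'D_(basis_vec j) (fun q => two_form_coef F q k i) q
    + 'D_(basis_vec k) (fun q => two_form_coef F q i j) q = 0.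

(* The biderivation with {q_i,q_j} = 0, {q_i,p_j} = delta_ij and
   {p_i,p_j} = F_ij. *)
Definition magnetic_bracket (F : two_form) (f h : phase R N -> R)
    (m : phase R N) : R :=
  canonical_bracket f h m
  + \sum_(i < N) \sum_(j < N) two_form_coef F m.1 i j * d_p i f m * d_p j h m.

Definition quad_form (A : 'M[R]_N) (p : 'rV[R]_N) : R :=
  \sum_(i < N) \sum_(j < N) A i j * p 0 i * p 0 j.

Record ham_system := HamSystem {
  pbracket : (phase R N -> R) -> (phase R N -> R) -> phase R N -> R;
  energy : phase R N -> R }.

(* [metric q] is the matrix (h_ij(q)). *)
Definition charged_particle (metric : 'rV[R]_N -> 'M[R]_N) (F : two_form) :
    ham_system :=
  HamSystem (magnetic_bracket F)
    (fun m => 2^-1 * quad_form (invmx (metric m.1)) m.2).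

Definition ham_equivalent (S1 S2 : ham_system) : Prop :=
  exists phi : phase R N -> phase R N,
    [/\ diffeomorphism phi,
        forall m, (phi m).1 = m.1,
        forall f h : phase R N -> R, smooth f -> smooth h -> forall m,
          pbracket S1 (f \o phi) (h \o phi) m = pbracket S2 f h (phi m)
      & forall m, energy S1 m = energy S2 (phi m)].

End HamiltonianSystems.

Arguments ham_system : clear implicits.
Arguments two_form : clear implicits.

Section Heisenberg.
Context {R : realType} {n : nat}.

(* A point (x, y, z) of H_{2n+1}, or a tangent vector in the global
   coordinates, is a row of length (n + n) + 1. *)
Notation H := 'rV[R]_(n + n + 1).

Definition ix (k : 'I_n) : 'I_(n + n + 1) := lshift 1 (lshift n k).
Definition iy (k : 'I_n) : 'I_(n + n + 1) := lshift 1 (rshift n k).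
Definition iz : 'I_(n + n + 1) := rshift (n + n) ord0.

Definition heis_mx (m : H) : 'M[R]_(1 + (n + 1)) :=
  block_mx 1%:M (row_mx (lsubmx (lsubmx m)) (rsubmx m))
           0 (block_mx 1%:M (rsubmx (lsubmx m))^T 0 1%:M).

Definition heis_mul (m m' : H) : H :=
  m + m' + (\sum_(k < n) m 0 (ix k) * m' 0 (iy k)) *: basis_vec iz.

Definition heis_metric (sigma : 'I_n -> R) (tau : R) (m u v : H) : R :=
  let theta w := w 0 iz - \sum_(k < n) m 0 (ix k) * w 0 (iy k) in
  \sum_(k < n) sigma k * (u 0 (ix k) * v 0 (ix k) + u 0 (iy k) * v 0 (iy k))
  + tau * (theta u * theta v).

(* (Z_a) = (X_1, ..., X_n, Y_1, ..., Y_n), the frame of D_R. *)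
Definition frame (a : 'I_(n + n)) (m : H) : H :=
  match fintype.split a with
  | inl k => basis_vec (ix k) + m 0 (iy k) *: basis_vec iz
  | inr k => basis_vec (iy k)
  end.

Definition gram (sigma : 'I_n -> R) (tau : R) (m : H) : 'M[R]_(n + n) :=
  \matrix_(a, b) heis_metric sigma tau m (frame a m) (frame b m).

(* The vector (P_a), where P_a(m, lambda) = lambda(Z_a(m)). *)
Definition frame_momenta (s : phase R (n + n + 1)) : 'rV[R]_(n + n) :=
  \row_a \sum_i s.2 0 i * frame a s.1 0 i.

Definition LR_system (sigma : 'I_n -> R) (tau : R) :
    ham_system R (n + n + 1) :=
  HamSystem canonical_bracket
    (fun s => 2^-1 * quad_form (invmx (gram sigma tau s.1)) (frame_momenta s)).

Definition level (C : R) (s : phase R (n + n + 1)) : Prop := s.2 0 iz = C.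

Definition z_translate (t : R) (s : phase R (n + n + 1)) :
    phase R (n + n + 1) := (s.1 + t *: basis_vec iz, s.2).

Definition reduction_proj (s : phase R (n + n + 1)) : phase R (n + n) :=
  (lsubmx s.1, lsubmx s.2).

Definition level_section (C : R) (s : phase R (n + n)) :
    phase R (n + n + 1) := (row_mx s.1 0, row_mx s.2 C%:M).

(* The quotient of the level by z-translations is T^*R^{2n} with its canonical
   bracket; the Hamiltonian, being z-invariant, is read off on the slice
   z = 0.  Lemmas [reduction_proj_fiber], [reduced_bracket] and
   [reduced_energy] below check that this is the reduced system. *)
Definition reduced_LR_system (sigma : 'I_n -> R) (tau C : R) :
    ham_system R (n + n) :=
  HamSystem canonical_bracket
    (fun s => energy (LR_system sigma tau) (level_section C s)).

(* D + tau (Jq)(Jq)^T *)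
Definition particle_metric (sigma : 'I_n -> R) (tau : R) (q : 'rV[R]_(n + n)) :
    'M[R]_(n + n) :=
  let D := diag_mx (row_mx (\row_k sigma k) (\row_k sigma k)) in
  let J := block_mx 0 (- 1%:M) 1%:M 0 : 'M[R]_(n + n) in
  D + tau *: ((J *m q^T) *m (J *m q^T)^T).

(* C * sum_i dx_i /\ dy_i *)
Definition magnetic_field (C : R) : two_form R (n + n) :=
  fun _ u v => C * \sum_(i < n) wedge (dq (lshift n i)) (dq (rshift n i)) u v.

End Heisenberg.

Section Sanity.
Context {R : realType} {n : nat}.
Context (sigma : 'I_n -> R) (tau C : R).
Notation H := 'rV[R]_(n + n + 1).

Lemma ixE (m : H) k : m 0 (ix k) = lsubmx (lsubmx m) 0 k.
Proof. by rewrite !mxE. Qed.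

Lemma iyE (m : H) k : m 0 (iy k) = rsubmx (lsubmx m) 0 k.
Proof. by rewrite !mxE. Qed.

Lemma basis_vecE N (i j : 'I_N) : basis_vec i 0 j = (j == i)%:R :> R.
Proof. by rewrite mxE eqxx. Qed.

Lemma ix_iz k : (ix k == @iz n) = false.
Proof. by apply/negbTE; rewrite eq_lrshift. Qed.

Lemma iy_iz k : (iy k == @iz n) = false.
Proof. by apply/negbTE; rewrite eq_lrshift. Qed.

Lemma ix_ix (k l : 'I_n) : (ix k == ix l) = (k == l).
Proof. by rewrite !eq_lshift. Qed.

Lemma iy_iy (k l : 'I_n) : (iy k == iy l) = (k == l).
Proof. by rewrite eq_lshift eq_rshift. Qed.

Lemma ix_iy (k l : 'I_n) : (ix k == iy l) = false.
Proof. by rewrite eq_lshift eq_lrshift. Qed.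

Lemma iy_ix (k l : 'I_n) : (iy k == ix l) = false.
Proof. by rewrite eq_lshift eq_rlshift. Qed.

Lemma heis_mul_x (m m' : H) k :
  heis_mul m m' 0 (ix k) = m 0 (ix k) + m' 0 (ix k).
Proof. by rewrite /heis_mul 3!mxE basis_vecE ix_iz mulr0 addr0. Qed.

Lemma heis_mul_y (m m' : H) k :
  heis_mul m m' 0 (iy k) = m 0 (iy k) + m' 0 (iy k).
Proof. by rewrite /heis_mul 3!mxE basis_vecE iy_iz mulr0 addr0. Qed.

Lemma heis_mul_z (m m' : H) :
  heis_mul m m' 0 iz
  = m 0 iz + m' 0 iz + \sum_(k < n) m 0 (ix k) * m' 0 (iy k).
Proof. by rewrite /heis_mul 3!mxE basis_vecE eqxx mulr1. Qed.

Lemma heis_mxM (m m' : H) :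
  heis_mx m *m heis_mx m' = heis_mx (heis_mul m m').
Proof.
rewrite /heis_mx mulmx_block !mul_row_block !mulmx_block.
rewrite !(mulmx0, mul0mx, mul1mx, mulmx1, addr0, add0r) add_row_mx.
congr block_mx.
  congr row_mx; first by apply/rowP => k; rewrite mxE -!ixE heis_mul_x addrC.
  apply/rowP => j; rewrite ord1 [RHS]mxE heis_mul_z !mxE.
  under eq_bigr do rewrite !mxE.
  by rewrite addrA addrAC [m 0 iz + _]addrC.

congr block_mx.
by apply/colP => k; rewrite [RHS]mxE -iyE heis_mul_y !mxE addrC.
Qed.

Lemma derive_const_quotient (V W : normedModType R) (f : V -> W) (x v : V) w :
  (forall t : R, f (t *: v + x) - f x = t *: w) -> 'D_v f x = w.
Proof.
move=> fE; apply: cvg_lim => //.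
apply: cvg_near_cst.
near=> t; rewrite /= fE scalerA mulVf ?scale1r//.
by near: t; exact: nbhs_dnbhs_neq.
Unshelve. all: by end_near. Qed.

Lemma derive_heis_mull (a m u : H) :
  'D_u (heis_mul a) m
  = u + (\sum_(k < n) a 0 (ix k) * u 0 (iy k)) *: basis_vec iz.
Proof.
apply: derive_const_quotient => t; apply/rowP => i; rewrite /heis_mul !mxE.
set d := (_ == _)%:R.
under eq_bigr do rewrite !mxE mulrDr mulrCA.
rewrite big_split /= -mulr_sumr; ring.
Qed.

Lemma derive_heis_mulr (a m u : H) :
  'D_u (heis_mul^~ a) m
  = u + (\sum_(k < n) u 0 (ix k) * a 0 (iy k)) *: basis_vec iz.
Proof.
apply: derive_const_quotient => t; apply/rowP => i; rewrite /heis_mul !mxE.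
set d := (_ == _)%:R.
under eq_bigr do rewrite !mxE mulrDl -mulrA.
rewrite big_split /= -mulr_sumr; ring.
Qed.

Lemma heis_metric_left_invariant (a m u v : H) :
  heis_metric sigma tau (heis_mul a m)
    ('D_u (heis_mul a) m) ('D_v (heis_mul a) m)
  = heis_metric sigma tau m u v.
Proof.
pose dL (w : H) := w + (\sum_(k < n) a 0 (ix k) * w 0 (iy k)) *: basis_vec iz.
have dLx w k : dL w 0 (ix k) = w 0 (ix k).
  by rewrite !mxE /= ix_iz mulr0 addr0.
have dLy w k : dL w 0 (iy k) = w 0 (iy k).
  by rewrite !mxE /= iy_iz mulr0 addr0.
have dLz w : dL w 0 iz = w 0 iz + \sum_(k < n) a 0 (ix k) * w 0 (iy k).
  by rewrite !mxE /= eqxx mulr1.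
have theta w : dL w 0 iz - \sum_(k < n) heis_mul a m 0 (ix k) * dL w 0 (iy k)
    = w 0 iz - \sum_(k < n) m 0 (ix k) * w 0 (iy k).
  under eq_bigr do rewrite heis_mul_x dLy mulrDl.
  by rewrite big_split /= dLz; ring.
rewrite !derive_heis_mull -!/(dL _) /heis_metric !theta; congr (_ + _).
by apply: eq_bigr => k _; rewrite !dLx !dLy.
Qed.

Lemma frame_right_invariant (b : 'I_(n + n)) (a m : H) :
  'D_(frame b m) (heis_mul^~ a) m = frame b (heis_mul m a).
Proof.
rewrite derive_heis_mulr /frame; case: (fintype.split b) => l.
  rewrite heis_mul_y scalerDl -addrA; congr (_ + (_ + _ *: _)).
  rewrite (bigD1 l) //= big1 ?addr0 => [|k kl].
    by rewrite !mxE /= eqxx ix_iz mulr0 addr0 mul1r.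
  by rewrite !mxE /= ix_ix (negbTE kl) ix_iz mulr0 addr0 mul0r.
rewrite big1 ?scale0r ?addr0 // => k _.
by rewrite !mxE /= ix_iy mul0r.
Qed.

Lemma frame_row_mx (a : 'I_(n + n)) (m : H) :
  frame a (row_mx (lsubmx m) 0) = frame a m.
Proof.
rewrite /frame; case: (fintype.split a) => k //.
by rewrite (row_mxEl (lsubmx m)) mxE.
Qed.

Lemma frame_z_translate (a : 'I_(n + n)) t (s : phase R (n + n + 1)) :
  frame a (z_translate t s).1 = frame a s.1.
Proof.
rewrite /frame; case: (fintype.split a) => k //.
by rewrite !mxE /= iy_iz mulr0 addr0.
Qed.

Lemma reduction_proj_section (s : phase R (n + n)) :
  level C (level_section C s) /\ reduction_proj (level_section C s) = s.
Proof.
split; first by rewrite /level row_mxEr !mxE.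
by case: s => q p; rewrite /reduction_proj /= !row_mxKl.
Qed.

(* The points of the quotient are the orbits of z-translation in the level. *)
Lemma reduction_proj_fiber (s s' : phase R (n + n + 1)) :
  level C s -> level C s' ->
  reduction_proj s = reduction_proj s' <-> exists t, s' = z_translate t s.
Proof.
case: s s' => [m l] [m' l']; rewrite /level /= => lC lC'.
split=> [[em el]|[t [-> ->]]]; last first.
  congr pair; apply/rowP => i; rewrite !mxE /= eq_lrshift mulr0 addr0 //.
exists (m' 0 iz - m 0 iz); congr pair; apply/rowP => i.
  rewrite -[i]splitK; case: (fintype.split i) => j /=.
    move/rowP: em => /(_ j); rewrite !mxE => ->.
    by rewrite eq_lrshift mulr0 addr0.
  by rewrite ord1 !mxE /= eqxx mulr1 addrC subrK.
rewrite -[i]splitK; case: (fintype.split i) => j /=.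
  by move/rowP: el => /(_ j); rewrite !mxE.
by rewrite ord1 lC lC'.
Qed.

Lemma heis_metric_base (m m' u v : H) :
  (forall k, m 0 (ix k) = m' 0 (ix k)) ->
  heis_metric sigma tau m u v = heis_metric sigma tau m' u v.
Proof.
move=> e; rewrite /heis_metric; congr (_ + _ * (_ * _)); congr (_ - _);
  by apply: eq_bigr => k _; rewrite e.
Qed.

(* The Hamiltonian of the LR system is cyclic in z, so lambda_{2n+1} is
   conserved. *)
Lemma LR_energy_z_invariant t (s : phase R (n + n + 1)) :
  energy (LR_system sigma tau) (z_translate t s) = energy (LR_system sigma tau) s.
Proof.
rewrite /LR_system /=; congr (_ * _).
have -> : gram sigma tau (z_translate t s).1 = gram sigma tau s.1.
  apply/matrixP => a b; rewrite !mxE !frame_z_translate.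
  by apply: heis_metric_base => k; rewrite !mxE /= ix_iz mulr0 addr0.
congr quad_form; apply/rowP => a; rewrite !mxE.
by apply: eq_bigr => i _; rewrite frame_z_translate.
Qed.

Lemma LR_momentum_conserved (s : phase R (n + n + 1)) :
  canonical_bracket (fun s => s.2 0 iz) (energy (LR_system sigma tau)) s = 0.
Proof.
apply: big1 => i _; rewrite {1}/d_q {2}/d_p.
have -> : 'D_(basis_vec i, 0) (fun s : phase R (n + n + 1) => s.2 0 iz) s = 0.
  by apply: derive_const_quotient => t /=; rewrite !mxE scaler0 mulr0 add0r subrr.
have -> : 'D_(0, basis_vec i) (fun s : phase R (n + n + 1) => s.2 0 iz) s
    = (@iz n == i)%:R.
  by apply: derive_const_quotient => t /=; rewrite !mxE /= addrK.
rewrite mul0r sub0r; case: eqP => [<-|_]; last by rewrite mul0r oppr0.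
rewrite mul1r /d_q (derive_const_quotient (w := 0)) ?oppr0 // => t.
rewrite scaler0 -(LR_energy_z_invariant t s) /z_translate.
apply/eqP; rewrite subr_eq0; apply/eqP; congr energy.
by case: s => m l; congr pair; rewrite /= ?scaler0 ?add0r // addrC.
Qed.

Lemma reduced_energy (s : phase R (n + n + 1)) : level C s ->
  energy (reduced_LR_system sigma tau C) (reduction_proj s)
  = energy (LR_system sigma tau) s.
Proof.
move=> sC; rewrite -(LR_energy_z_invariant (- s.1 0 iz) s) /=.
have [h1 h2] := reduction_proj_section (reduction_proj s).
have sC' : level C (z_translate (- s.1 0 iz) s) by [].
congr (_ * quad_form (invmx (gram _ _ _)) (frame_momenta _)).
- apply/rowP => i; rewrite -[i]splitK; case: (fintype.split i) => j /=.
    by rewrite row_mxEl !mxE /= eq_lrshift mulr0 addr0.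
  by rewrite ord1 row_mxEr !mxE /= eqxx mulr1 subrr.
- congr pair; apply/rowP => i; rewrite -[i]splitK.
    case: (fintype.split i) => j /=.
      by rewrite row_mxEl !mxE /= eq_lrshift mulr0 addr0.
    by rewrite ord1 row_mxEr !mxE /= eqxx mulr1 subrr.
  case: (fintype.split i) => j /=; first by rewrite row_mxEl !mxE.
  by rewrite ord1 row_mxEr !mxE eqxx mulr1n -sC.
Qed.

Lemma reduced_bracket (f h : phase R (n + n) -> R) (s : phase R (n + n + 1)) :
  pbracket (LR_system sigma tau) (f \o reduction_proj) (h \o reduction_proj) s
  = pbracket (reduced_LR_system sigma tau C) f h (reduction_proj s).
Proof.
have derive_proj (k : phase R (n + n) -> R) v :
    'D_v (k \o reduction_proj) s = 'D_(reduction_proj v) k (reduction_proj s).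
  rewrite /derive; set F := (fun t => t^-1 *: _); set G := (fun t => t^-1 *: _).
  suff -> : F = G by [].
  apply/funext => t; rewrite /F /G /=; congr (_ *: (k _ - _)).
  by congr pair; apply/rowP => i; rewrite !mxE.
have bl i : lsubmx (basis_vec (lshift 1 i)) = basis_vec i :> 'rV[R]_(n + n).
  by apply/rowP => j; rewrite !mxE /= eq_lshift.
have br i : lsubmx (basis_vec (rshift (n + n) i : 'I_(n + n + 1))) = 0 :> 'rV[R]_(n + n).
  by apply/rowP => j; rewrite !mxE /= eq_lrshift.
have l0 : lsubmx (0 : H) = 0 by apply/rowP => j; rewrite !mxE.
rewrite /= /canonical_bracket big_split_ord /= [X in _ + X]big1 ?addr0 => [|i _].
  apply: eq_bigr => i _.
  by rewrite /d_q /d_p !derive_proj /reduction_proj /= !bl l0.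
rewrite /d_q /d_p !derive_proj /reduction_proj /= !br l0.
have -> : ((0, 0) : phase R (n + n)) = 0 by [].
by rewrite !derive0 !mul0r subr0.
Qed.

Lemma magnetic_field_coef (q : 'rV[R]_(n + n)) (i j : 'I_n) :
  two_form_coef (magnetic_field C) q (lshift n i) (rshift n j)
  = C * (i == j)%:R.
Proof.
rewrite /two_form_coef /magnetic_field; congr (_ * _).
rewrite (bigD1 i) //= big1 ?addr0 => [|k ki]; rewrite /wedge /dq !basis_vecE.
  by rewrite !(eq_lshift, eq_rshift, eq_lrshift) eqxx mul1r mul0r subr0.
by rewrite !(eq_lshift, eq_rshift, eq_lrshift) (negbTE ki) !mul0r subr0.
Qed.

Lemma magnetic_field_closed : closed_two_form (magnetic_field (n := n) C).
Proof. by move=> i j k q; rewrite !derive_cst !addr0. Qed.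

Lemma particle_metric_pos (q p : 'rV[R]_(n + n)) :
  (forall k, 0 < sigma k) -> 0 < tau -> p != 0 ->
  0 < (p *m particle_metric sigma tau q *m p^T) 0 0.
Proof.
move=> s0 t0 p0; rewrite /particle_metric.
set w := _ *m q^T; set d := row_mx _ _.
have d0 k : 0 < d 0 k.
  by rewrite -[k]splitK; case: (fintype.split k) => j;
    rewrite /d /= ?row_mxEl ?row_mxEr mxE.
have -> : p *m (diag_mx d + tau *: (w *m w^T)) *m p^T
    = p *m diag_mx d *m p^T + tau *: ((p *m w) *m (p *m w)^T).
  by rewrite mulmxDr mulmxDl -scalemxAr -scalemxAl (trmx_mul p w) !mulmxA.
rewrite mxE ltr_pwDl //; last first.
  rewrite mxE mulr_ge0 ?(ltW t0) // mxE big_ord1 [_^T _ _]mxE -expr2.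
  exact: sqr_ge0.
have -> : (p *m diag_mx d *m p^T) 0 0 = \sum_j p 0 j ^+ 2 * d 0 j.
  rewrite mul_mx_diag mxE; apply: eq_bigr => j _.
  by rewrite mxE [p^T _ _]mxE mulrAC expr2.
have /rV0Pn[k pk] := p0.
have pk2 : 0 < p 0 k ^+ 2 by rewrite lt_def sqrf_eq0 pk sqr_ge0.
rewrite (bigD1 k) //=; apply: ltr_pwDl; first by rewrite mulr_gt0.
by apply: sumr_ge0 => j _; rewrite mulr_ge0 ?sqr_ge0 // ltW.
Qed.

End Sanity.

(* Main.v *)
Require Import Defs.
From HB Require Import structures.
From mathcomp Require Import all_boot all_order all_algebra.
From mathcomp Require Import all_classical all_reals all_analysis.
From mathcomp Require Import ring.
Import Order.TTheory GRing.Theory Num.Theory.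
Import numFieldNormedType.Exports.
Local Open Scope ring_scope.

(** The equivalence is the passage from canonical to kinetic momenta.  On the
    level where the momentum conjugate to z equals C, the frame momenta are
    P(X_k) = lambda_k + C y_k and P(Y_k) = lambda_(n+k)
    ([frame_momenta_level_section]), so the linear shear
    (q, lambda) |-> (q, P) turns the reduced Hamiltonian into the kinetic
    energy of the inverse Gram matrix.  This Gram matrix is the metric of the
    particle ([gram_level_section]), because the contact form
    dz - sum_k x_k dy_k takes the values - Jq on the right-invariant frame.

    The shear is a linear isomorphism over the identity of the q-space, hence
    a diffeomorphism ([fibre_shear_diffeo]).  It does not preserve the
    canonical bracket: the new momenta have brackets
    {P(X_k), P(Y_l)} = C delta_kl, and all other brackets among them vanish.
    The chain rule extends this from coordinates to all smooth functions
    ([fibre_shear_bracket]), and the resulting bracket is the magnetic one for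
    the field C sum_k dx_k /\ dy_k ([magnetic_field_potential]). *)

Lemma mulmxr_continuous {R : realType} {m n : nat} (A : 'M[R]_(m, n)) :
  continuous (fun q : 'rV[R]_m => q *m A).
Proof.
under eq_fun do rewrite mulmx_sum_row.
apply: continuous_big => [|i _ q]; first exact: add_continuous.
by apply: (@cvgZr_tmp _ _ _ (nbhs q)); exact: coord_continuous.
Qed.

Lemma Ck_cst {R : realType} {V W : normedModType R} (w : W) k :
  Ck k (fun _ : V => w).
Proof.
elim: k w => [|k IHk] w /=; first by move=> x; exact: cvg_cst.
split=> [x|v]; first exact: differentiable_cst.
by under eq_fun do rewrite derive_cst.
Qed.

(** The directional derivatives of a continuous linear map are constant
    functions, so all regularity beyond the first order is that of constants. *)
Lemma linear_smooth {R : realType} {V W : normedModType R}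
  (f : {linear V -> W}) : continuous f -> smooth f.
Proof.
move=> fc; case=> [|k] //=; split=> [x|v]; first exact: linear_differentiable.
suff -> : (fun x => 'D_v f x) = fun=> f v by exact: Ck_cst.
apply/funext => x; rewrite deriveE ?diff_lin //; exact: linear_differentiable.
Qed.

(** By linearity the difference quotients on the two sides are the same
    function, hence [f] may be arbitrary. *)
Lemma derive_comp_linear {R : realType} {U V W : normedModType R}
    (L : {linear U -> V}) (f : V -> W) (x v : U) :
  'D_v (f \o L) x = 'D_(L v) f (L x).
Proof.
rewrite /derive; set F := (fun t => t^-1 *: _); set G := (fun t => t^-1 *: _).
suff -> : F = G by [].
by apply/funext => t; rewrite /F /G /= linearP.
Qed.

(** The map (q, p) |-> (q, p + a(q)) for the linear one-form a(q) = q A: the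
    change from canonical to kinetic momentum for the vector potential [a]. *)
Definition fibre_shear {R : realType} {N : nat} (A : 'M[R]_N)
    (s : phase R N) : phase R N :=
  (s.1, s.2 + s.1 *m A).

Lemma fibre_shear_linear {R : realType} {N : nat} (A : 'M[R]_N) :
  linear (fibre_shear A).
Proof.
move=> a [q p] [q' p']; rewrite /fibre_shear /=; congr pair.
rewrite [in LHS]mulmxDl -scalemxAl [RHS]/=.
by rewrite scalerDr addrACA.
Qed.

HB.instance Definition _ (R : realType) (N : nat) (A : 'M[R]_N) :=
  GRing.isLinear.Build R (phase R N) (phase R N) *:%R (fibre_shear A)
    (fibre_shear_linear A).

Lemma fibre_shear_continuous {R : realType} {N : nat} (A : 'M[R]_N) :
  continuous (fibre_shear A).
Proof.
have cfst : continuous (fun s : phase R N => s.1) by move=> s; exact: cvg_fst.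
have csnd : continuous (fun s : phase R N => s.2) by move=> s; exact: cvg_snd.
have cshift : continuous (fun s : phase R N => s.2 + s.1 *m A).
  move=> s; apply: (@cvgD _ _ _ (nbhs s)); first exact: csnd.
  exact: (continuous_comp (cfst s) (mulmxr_continuous A s.1)).
by move=> s; exact: cvg_pair (cfst s) (cshift s).
Qed.

Lemma fibre_shearK {R : realType} {N : nat} (A : 'M[R]_N) :
  cancel (fibre_shear A) (fibre_shear (- A)).
Proof. by move=> [q p]; rewrite /fibre_shear /= mulmxN addrK. Qed.

Lemma fibre_shear_diffeo {R : realType} {N : nat} (A : 'M[R]_N) :
  diffeomorphism (fibre_shear A).
Proof.
have sm B : smooth (fibre_shear B).
  by apply: linear_smooth; exact: fibre_shear_continuous.
split=> //; exists (fibre_shear (- A)) => //.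
split; first exact: fibre_shearK.
by rewrite -{2}(opprK A); exact: fibre_shearK.
Qed.

Lemma d_p_fibre_shear {R : realType} {N : nat} (A : 'M[R]_N) (i : 'I_N)
    (f : phase R N -> R) (m : phase R N) :
  d_p i (f \o fibre_shear A) m = d_p i f (fibre_shear A m).
Proof.
rewrite /d_p derive_comp_linear /=.
have -> // : fibre_shear A (0, basis_vec i) = (0, basis_vec i).
by rewrite /fibre_shear /= mul0mx addr0.
Qed.

(** Moving along q_i at fixed canonical momentum also moves the kinetic
    momentum, by the i-th row of [A].  Splitting the derivative along this
    combined direction is where differentiability of [f] enters. *)
Lemma d_q_fibre_shear {R : realType} {N : nat} (A : 'M[R]_N) (i : 'I_N)
    (f : phase R N -> R) (m : phase R N) :
  differentiable f (fibre_shear A m) ->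
  d_q i (f \o fibre_shear A) m
  = d_q i f (fibre_shear A m)
    + \sum_j A i j * d_p j f (fibre_shear A m).
Proof.
move=> df; rewrite /d_q /d_p derive_comp_linear /=.
have -> : fibre_shear A (basis_vec i, 0)
    = (basis_vec i, 0) + \sum_j A i j *: (0, basis_vec j) :> phase R N.
  have -> : \sum_j A i j *: ((0, basis_vec j) : phase R N)
      = (0, \sum_j A i j *: basis_vec j).
    elim/big_ind2 : _ => // [u x v y -> ->|j _].
      by congr pair; rewrite /= addr0.
    by congr pair; rewrite /= scaler0.
  rewrite /fibre_shear; congr pair; rewrite /= ?addr0 // !add0r.
  rewrite -rowE (row_sum_delta (row i A)).
  by apply: eq_bigr => j _; rewrite mxE.
rewrite !deriveE // linearD linear_sum; congr (_ + _).
by apply: eq_bigr => j _; rewrite linearZ deriveE.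
Qed.

(** Kinetic momenta P_i = p_i + sum_k q_k A_ki satisfy
    {P_i, P_j} = A_ji - A_ij, which is minus the (i, j) coefficient of the
    exterior derivative of the vector potential; this is why a shear with linear
    potential trades the canonical bracket for a constant magnetic field. *)
Lemma fibre_shear_bracket {R : realType} {N : nat} (A : 'M[R]_N)
    (F : two_form R N) (f h : phase R N -> R) (m : phase R N) :
  (forall i j, two_form_coef F m.1 i j = A j i - A i j) ->
  differentiable f (fibre_shear A m) ->
  differentiable h (fibre_shear A m) ->
  canonical_bracket (f \o fibre_shear A) (h \o fibre_shear A) m
  = magnetic_bracket F f h (fibre_shear A m).
Proof.
move=> FA df dh; rewrite /magnetic_bracket /canonical_bracket.
under eq_bigr do rewrite !d_p_fibre_shear !d_q_fibre_shear //.
set s := fibre_shear A m.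
under [X in _ = _ + X]eq_bigr do under eq_bigr do rewrite FA 2!mulrBl.
under [X in _ = _ + X]eq_bigr do rewrite sumrB.
(* Exchanging the indices in the term with A_ji makes every summand on the right
   involve the same i-th row of [A] as on the left. *)
rewrite [X in _ = _ + X]sumrB [X in _ = _ + (X - _)]exchange_big /=.
rewrite -sumrB -big_split /=.
apply: eq_bigr => i _.
rewrite mulrDl mulrDr mulr_suml mulr_sumr opprD addrACA; congr (_ + (_ - _)).
by apply: eq_bigr => j _; ring.
Qed.

(** The matrix of the one-form (x, y) |-> (C y, 0), that is, of
    C sum_k y_k dx_k. *)
Definition magnetic_potential {R : realType} (n : nat) (C : R) :
    'M[R]_(n + n) :=
  block_mx 0 0 C%:M 0.

(** With the sign convention of [fibre_shear_bracket] the field is minus the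
    exterior derivative of the potential, and dy_k /\ dx_k = - dx_k /\ dy_k. *)
Lemma magnetic_field_potential {R : realType} {n : nat} (C : R)
    (q : 'rV[R]_(n + n)) (i j : 'I_(n + n)) :
  two_form_coef (magnetic_field C) q i j
  = magnetic_potential n C j i - magnetic_potential n C i j.
Proof.
rewrite /magnetic_potential.
have anti a b : two_form_coef (@magnetic_field R n C) q a b
    = - two_form_coef (magnetic_field C) q b a.
  rewrite /two_form_coef /magnetic_field -mulrN -sumrN; congr (_ * _).
  by apply: eq_bigr => k _; rewrite /wedge opprB.
(* Two basis vectors in the x-plane, or two in the y-plane, are both killed by
   one factor of every dx_k /\ dy_k. *)
have isotropic a b (e : 'I_n -> 'I_(n + n)) :
    e = @lshift n n \/ e = @rshift n n ->
    (forall k, dq (e k) (basis_vec a) = 0 :> R) ->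
    (forall k, dq (e k) (basis_vec b) = 0 :> R) ->
    two_form_coef (@magnetic_field R n C) q a b = 0.
  move=> eE ea eb; rewrite /two_form_coef /magnetic_field big1 ?mulr0 // => k _.
  have := eb k; have := ea k; rewrite /wedge.
  by case: eE => -> -> ->; rewrite !(mul0r, mulr0) subr0.
rewrite -[i]splitK -[j]splitK.
case: (fintype.split i) => k; case: (fintype.split j) => l /=.
- rewrite !block_mxEul !mxE subr0.
  rewrite (isotropic _ _ (@rshift n n)) //; first by right.
  + by move=> a; rewrite /dq basis_vecE eq_rlshift.
  + by move=> a; rewrite /dq basis_vecE eq_rlshift.
- rewrite magnetic_field_coef block_mxEdl block_mxEur !mxE subr0.
  by rewrite mulr_natr eq_sym.
- rewrite anti magnetic_field_coef block_mxEdl block_mxEur !mxE sub0r.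
  by rewrite mulr_natr eq_sym.
- rewrite !block_mxEdr !mxE subr0.
  rewrite (isotropic _ _ (@lshift n n)) //; first by left.
  + by move=> a; rewrite /dq basis_vecE eq_lrshift.
  + by move=> a; rewrite /dq basis_vecE eq_lrshift.
Qed.

Lemma sum_basis_vec {R : realType} {N : nat} (v : 'rV[R]_N) (i : 'I_N) :
  \sum_j v 0 j * basis_vec i 0 j = v 0 i.
Proof.
rewrite (bigD1 i) //= big1 ?addr0 => [|j ji]; first by rewrite mxE !eqxx mulr1.
by rewrite basis_vecE (negbTE ji) mulr0.
Qed.

Lemma frame_inl {R : realType} {n : nat} (k : 'I_n) (m : 'rV[R]_(n + n + 1)) :
  frame (lshift n k) m = basis_vec (ix k) + m 0 (iy k) *: basis_vec iz.
Proof. by rewrite /frame (unsplitK (inl k)). Qed.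

Lemma frame_inr {R : realType} {n : nat} (k : 'I_n) (m : 'rV[R]_(n + n + 1)) :
  frame (rshift n k) m = basis_vec (iy k).
Proof. by rewrite /frame (unsplitK (inr k)). Qed.

(** Pairing the momentum (p, C) with X_k = d/dx_k + y_k d/dz gives
    p_k + C y_k, and with Y_k = d/dy_k gives p_(n+k): on the level the frame
    momenta are kinetic momenta for [magnetic_potential]. *)
Lemma frame_momenta_level_section {R : realType} {n : nat} (C : R)
    (s : phase R (n + n)) :
  frame_momenta (level_section C s)
  = (fibre_shear (magnetic_potential n C) s).2.
Proof.
case: s => q p; apply/rowP => a; rewrite /frame_momenta /fibre_shear mxE /=.
have shift : q *m magnetic_potential n C = row_mx (C *: rsubmx q) 0.
  rewrite -{1}(hsubmxK q) mul_row_block !mulmx0 !add0r.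
  by rewrite mul_mx_scalar.
rewrite shift mxE -[a]splitK; case: (fintype.split a) => k.
  rewrite [unsplit _]/= row_mxEl frame_inl; set lam := row_mx p _.
  under eq_bigr do
    rewrite [X in _ * X]mxE mulrDr [X in _ + _ * X]mxE mulrCA.
  rewrite big_split /= -mulr_sumr !sum_basis_vec /lam row_mxEr !row_mxEl.
  by rewrite !mxE /= mulr1n mulrC.
by rewrite [unsplit _]/= frame_inr sum_basis_vec row_mxEl row_mxEr mxE addr0.
Qed.

(** The one-form theta = dz - sum_k x_k dy_k takes the value y_k on X_k and
    - x_k on Y_k, hence equals - Jq along the frame, and the sign cancels in
    the rank-one term theta theta^T of the metric. *)
Lemma gram_level_section {R : realType} {n : nat} (sigma : 'I_n -> R)
    (tau C : R) (s : phase R (n + n)) :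
  gram sigma tau (level_section C s).1 = particle_metric sigma tau s.1.
Proof.
case: s => q p; rewrite /level_section [(_, _).1]/= [(_, _).1]/=.
set m := row_mx q 0.
pose Jq := block_mx 0 (- 1%:M) 1%:M 0 *m q^T : 'cV[R]_(n + n).
have mx k : m 0 (ix k) = q 0 (lshift n k) by rewrite row_mxEl.
have my k : m 0 (iy k) = q 0 (rshift n k) by rewrite row_mxEl.
have JqE : Jq = col_mx (- (rsubmx q)^T) (lsubmx q)^T.
  rewrite /Jq -{1}(hsubmxK q) tr_row_mx mul_block_col !mul0mx.
  by rewrite mulNmx !mul1mx add0r addr0.
have frame_x a k : frame a m 0 (ix k) = (a == lshift n k)%:R.
  rewrite -[a]splitK; case: (fintype.split a) => l /=.
    by rewrite frame_inl !mxE /= ix_iz mulr0 addr0 ix_ix eq_lshift eq_sym.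
  by rewrite frame_inr basis_vecE ix_iy eq_rlshift.
have frame_y a k : frame a m 0 (iy k) = (a == rshift n k)%:R.
  rewrite -[a]splitK; case: (fintype.split a) => l /=.
    by rewrite frame_inl !mxE /= iy_iz iy_ix mulr0 addr0 eq_lrshift.
  by rewrite frame_inr basis_vecE iy_iy eq_rshift eq_sym.
have theta a :
    frame a m 0 iz - \sum_(k < n) m 0 (ix k) * frame a m 0 (iy k) = - Jq a 0.
  under eq_bigr do rewrite mx frame_y.
  rewrite JqE -[a]splitK; case: (fintype.split a) => l /=.
    rewrite big1 => [|k _]; last by rewrite eq_lrshift mulr0.
    rewrite frame_inl my col_mxEu !mxE /= eqxx mulr1 opprK subr0.
    by rewrite eq_sym ix_iz add0r.
  rewrite frame_inr basis_vecE eq_sym iy_iz sub0r col_mxEd !mxE.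
  rewrite (bigD1 l) //= eqxx mulr1 big1 ?addr0 // => k kl.
  by rewrite eq_rshift eq_sym (negbTE kl) mulr0.
apply/matrixP => a b; rewrite /gram /particle_metric mxE /heis_metric.
rewrite !theta -/Jq [RHS]mxE [X in _ = _ + X]mxE [X in _ = _ + _ * X]mxE.
rewrite big_ord1 [Jq^T 0 b]mxE mulrNN; congr (_ + _).
under eq_bigr do rewrite !frame_x !frame_y mulrDr.
rewrite big_split /= mxE -[a]splitK; case: (fintype.split a) => l /=.
  rewrite (bigD1 l) //= [X in _ + X + _]big1 ?addr0 => [|k kl]; last first.
    by rewrite eq_lshift eq_sym (negbTE kl) mul0r mulr0.
  rewrite big1 ?addr0 => [|k _]; last by rewrite eq_lrshift mul0r mulr0.
  by rewrite eqxx mul1r row_mxEl mxE mulr_natr eq_sym.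
rewrite big1 ?add0r => [|k _]; last by rewrite eq_rlshift mul0r mulr0.
rewrite (bigD1 l) //= big1 ?addr0 => [|k kl]; last first.
  by rewrite eq_rshift eq_sym (negbTE kl) mul0r mulr0.
by rewrite eqxx mul1r row_mxEr mxE mulr_natr eq_sym.
Qed.

Theorem proposition3p2 (R : realType) (n : nat) (sigma : 'I_n -> R) (tau C : R)
    (n_ge1 : (1 <= n)%N)
    (sigma_noninc : forall i j : 'I_n, (i <= j)%N -> sigma j <= sigma i)
    (sigma_last : forall i : 'I_n, i.+1 = n -> sigma i = 1)
    (tau_gt0 : 0 < tau) :
  ham_equivalent (reduced_LR_system sigma tau C)
    (charged_particle (particle_metric sigma tau) (magnetic_field C)).
Proof.
exists (fibre_shear (magnetic_potential n C)); split => //.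
- exact: fibre_shear_diffeo.
- move=> f h fs hs m; apply: fibre_shear_bracket.
  + exact: magnetic_field_potential.
  + by case: (fs 1%N).
  + by case: (hs 1%N).
- move=> m; rewrite /= -(gram_level_section sigma tau C m).
  congr (_ * quad_form _ _); exact: frame_momenta_level_section.
Qed.
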